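(* Let $b\in\mathbb{N}$ with $b\geq 2$ and $b\neq 3$. Then the number of integers $a$ with $1\leq a\leq b-1$, $(a,b)=1$ and $S(1,a,b)=0$ equals $$\phi\left(b,\left\lceil \frac{b+1}{3}\right\rceil,\left\lfloor \frac{2b-1}{3}\right\rfloor\right).$$
   Context: $\mathbb{N}$ denotes the positive integers and $(a,b)$ the greatest common divisor. For $n,a,b\in\mathbb{N}$ with $b\geq 2$, define $$S(n,a,b):=\sum_{m=1}^{b-1}\cot\left(\frac{\pi m}{b}\right)\sin^{3}\left(2\pi mn\frac{a}{b}\right).$$ The generalized totient function is $$\phi(n,A,B):=\sum_{\substack{A\leq k\leq B\\ (n,k)=1}}1,$$ the number of integers $k$ with $A\leq k\leq B$ and $(n,k)=1$ (equal to $0$ if there are none). *)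

(* Defs.v *)
From HB Require Import structures.
From mathcomp Require Import all_boot all_order all_algebra.
From mathcomp Require Import all_classical all_reals all_analysis.
Set Implicit Arguments.
Unset Strict Implicit.
Unset Printing Implicit Defensive.

Import Order.TTheory GRing.Theory Num.Theory.
Local Open Scope classical_set_scope.
Local Open Scope ring_scope.

Definition cot (R : realType) (x : R) : R := cos x / sin x.

Definition cot_sum (R : realType) (n a b : nat) : R :=
  \sum_(1 <= m < b)
    cot (pi * m%:R / b%:R) * sin (2 * pi * m%:R * n%:R * (a%:R / b%:R)) ^+ 3.

(* The index set is finite, so this finitely supported sum is the usual one;
   it is empty, and the value 0, when B < A. *)
Definition gtotient (n : nat) (A B : int) : nat :=
  \sum_(k \in [set k : int | A <= k <= B /\ coprimez n k]) 1%N.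

(* Main.v *)
(** Since [sin x ^+ 3 = (3 sin x - sin (3 x)) / 4], the sum [S(1, a, b)] is a
    combination of the discrete Fourier sums
    [T(k) = \sum_(1 <= m < b) cot (pi m / b) sin (2 pi m k / b)].
    The identity [cot t (sin (2 (k + 1) t) - sin (2 k t)) =
    cos (2 (k + 1) t) + cos (2 k t)] expresses [T(k + 1) - T(k)] by sums of
    cosines over all [b]-th roots of unity, whence [T(k) = b - 2 k] for
    [0 < k < b]; also [T] has period [b].  If [b] does not divide [3 a] and
    [j = floor (3 a / b)], then
    [4 S(1, a, b) = 3 T(a) - T(3 a - j b) = 2 b (1 - j)],
    so [S(1, a, b)] vanishes exactly when [b < 3 a < 2 b]. *)
Require Import Defs.
From HB Require Import structures.
From mathcomp Require Import all_boot all_order all_algebra.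
From mathcomp Require Import all_classical all_reals all_analysis.
From mathcomp Require Import zify ring lra.
Import Order.TTheory GRing.Theory Num.Theory.
Local Open Scope ring_scope.

Section CotangentSums.
Variable R : realType.
Implicit Types (x : R) (a b k m n : nat).

(** Each term [2 * sin x * cos (2 * x * m)] is [sin ((2 * m + 1) * x) - sin ((2 * m - 1) * x)]. *)
Lemma sum_cos_telescope x n :
  2 * sin x * \sum_(0 <= m < n) cos (2 * x * m%:R) =
  sin (2 * x * n%:R - x) + sin x.
Proof.
elim: n => [|n IHn].
  by rewrite big_geq // !mulr0 sub0r sinN addNr.
rewrite big_nat_recr //= mulrDr {}IHn.
have -> : 2 * x * n.+1%:R - x = 2 * x * n%:R + x by rewrite -natr1; ring.
by rewrite sinB sinD; ring.
Qed.

Lemma sin_pi_frac_neq0 b m : (0 < m < b)%N -> sin (pi * m%:R / b%:R) != 0 :> R.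
Proof.
move=> /andP[m_gt0 lt_mb].
have b_gt0 : 0 < b%:R :> R by rewrite ltr0n (leq_trans _ lt_mb).
apply/lt0r_neq0/sin_gt0_pi; rewrite ltr_pdivrMr // ltr_pM2l ?pi_gt0 //.
by rewrite ltr_nat lt_mb divr_gt0 // mulr_gt0 ?pi_gt0 ?ltr0n.
Qed.

Lemma sin_period x n : sin (x + 2 * pi * n%:R) = sin x.
Proof.
rewrite -[RHS](periodicn (@sinD2pi R) n); congr sin.
by rewrite -[in RHS]mulr_natr -[pi *+ 2]mulr_natl.
Qed.

(** At [x = pi * k / b] the telescoped right-hand side is [sin (- x) + sin x = 0], and [sin x] is
    nonzero, so the sum from [m = 0] vanishes; its term at [0] is 1. *)
Lemma sum_cos_roots b k : (0 < k < b)%N ->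
  \sum_(1 <= m < b) cos (2 * pi * m%:R * (k%:R / b%:R)) = - 1 :> R.
Proof.
move=> kb; have b_gt0 : (0 < b)%N by lia.
have b_neq0 : b%:R != 0 :> R by rewrite pnatr_eq0 -lt0n.
have := sum_cos_telescope (pi * k%:R / b%:R) b.
have -> : 2 * (pi * k%:R / b%:R) * b%:R - pi * k%:R / b%:R =
          - (pi * k%:R / b%:R) + 2 * pi * k%:R :> R by field.
rewrite sin_period sinN addNr big_ltn // mulr0 cos0.
move/eqP; rewrite !mulf_eq0 pnatr_eq0 (negbTE (sin_pi_frac_neq0 _ _ kb)) /=.
rewrite addrC addr_eq0 => /eqP <-.
by apply: eq_bigr => m _; congr cos; ring.
Qed.

Lemma cot_sinB b m k : (0 < m < b)%N ->
  cot (pi * m%:R / b%:R) * sin (2 * pi * m%:R * (k.+1%:R / b%:R)) =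
  cot (pi * m%:R / b%:R) * sin (2 * pi * m%:R * (k%:R / b%:R)) +
  (cos (2 * pi * m%:R * (k.+1%:R / b%:R)) +
   cos (2 * pi * m%:R * (k%:R / b%:R))) :> R.
Proof.
move=> mb; have st := sin_pi_frac_neq0 _ _ mb; rewrite /cot.
set t : R := pi * m%:R / b%:R in st *.
have -> : 2 * pi * m%:R * (k.+1%:R / b%:R) =
          2 * pi * m%:R * (k%:R / b%:R) + t + t :> R.
  by rewrite /t -natr1; ring.
set u : R := _ * (k%:R / _).
rewrite !(sinD, cosD).
(* Everything is now rational in the sines and cosines of [u] and [t], and the identity holds modulo
   [cos t ^+ 2 = 1 - sin t ^+ 2]. *)
have cs := cos2sin2 t.
by field: cs.
Qed.

Lemma sum_cot_sin b k : (0 < k < b)%N ->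
  \sum_(1 <= m < b)
    cot (pi * m%:R / b%:R) * sin (2 * pi * m%:R * (k%:R / b%:R)) =
  b%:R - 2 * k%:R :> R.
Proof.
have step j : \sum_(1 <= m < b)
    cot (pi * m%:R / b%:R) * sin (2 * pi * m%:R * (j.+1%:R / b%:R)) =
    \sum_(1 <= m < b)
      cot (pi * m%:R / b%:R) * sin (2 * pi * m%:R * (j%:R / b%:R)) +
    (\sum_(1 <= m < b) cos (2 * pi * m%:R * (j.+1%:R / b%:R)) +
     \sum_(1 <= m < b) cos (2 * pi * m%:R * (j%:R / b%:R))) :> R.
  by rewrite -!big_split /= !big_nat; apply: eq_bigr => m; apply: cot_sinB.
elim: k => [//|k IHk] kb; rewrite step (sum_cos_roots _ _ kb).
(* The step from 0 to 1 is special: the cosine sum at index 0 is [b - 1], which gives [b - 2]. Every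
   later step adds [- 2]. *)
have [k0|k_gt0] := posnP k.
  rewrite {}k0 in kb *.
  under eq_bigr do rewrite mul0r mulr0 sin0 mulr0.
  rewrite big1 //; under eq_bigr do rewrite mul0r mulr0 cos0.
  by rewrite sumr_const_nat natrB ?(ltnW kb) //; ring.
have kb' : (0 < k < b)%N by lia.
by rewrite IHk // sum_cos_roots // -natr1; ring.
Qed.

Lemma sin_tripleE x : sin x ^+ 3 = (3 * sin x - sin (3 * x)) / 4.
Proof.
have -> : 3 * x = x + x + x by ring.
rewrite !(sinD, cosD).
have -> : (sin x * cos x + cos x * sin x) * cos x +
  (cos x * cos x - sin x * sin x) * sin x =
  3 * sin x * cos x ^+ 2 - sin x ^+ 3 by ring.
by rewrite cos2sin2; field.
Qed.

Lemma cot_sum1E a b j : (0 < a < b)%N -> (j * b < 3 * a < j.+1 * b)%N ->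
  cot_sum R 1 a b = b%:R * (1 - j%:R) / 2.
Proof.
move=> ab /andP[ltj gtj].
have b_neq0 : b%:R != 0 :> R by rewrite pnatr_eq0; lia.
rewrite /cot_sum.
(* Both strict bounds matter: they place the residue [r] of [3 * a] in the range where [sum_cot_sin]
   applies. *)
set r := (3 * a - j * b)%N; have rb : (0 < r < b)%N by rewrite /r; lia.
have rE : 3 * a%:R = r%:R + j%:R * b%:R :> R.
  by rewrite -!natrM -natrD; congr _%:R; rewrite /r; lia.
have term m :
    cot (pi * m%:R / b%:R) * sin (2 * pi * m%:R * 1%:R * (a%:R / b%:R)) ^+ 3 =
    3 / 4 * (cot (pi * m%:R / b%:R) * sin (2 * pi * m%:R * (a%:R / b%:R))) -
    1 / 4 * (cot (pi * m%:R / b%:R) * sin (2 * pi * m%:R * (r%:R / b%:R))) :> R.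
  rewrite mulr1 sin_tripleE.
  have -> : 3 * (2 * pi * m%:R * (a%:R / b%:R)) =
      2 * pi * m%:R * (r%:R / b%:R) + 2 * pi * (m * j)%N%:R :> R.
    have -> : 3 * (2 * pi * m%:R * (a%:R / b%:R)) =
      2 * pi * m%:R * (3 * a%:R / b%:R) :> R by ring.
    by rewrite rE natrM; field.
  by rewrite sin_period; field.
rewrite (eq_bigr _ (fun m _ => term m)) sumrB -!mulr_sumr !sum_cot_sin //.
have -> : r%:R = 3 * a%:R - j%:R * b%:R :> R by rewrite rE addrK.
by field.
Qed.

Lemma cot_sum1_eq0 a b : (0 < a < b)%N -> coprime a b -> b <> 3%N ->
  (cot_sum R 1 a b == 0) = (b < 3 * a < 2 * b)%N.
Proof.
move=> ab co_ab b3.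
have b_neq0 : b%:R == 0 :> R = false by rewrite pnatr_eq0; lia.
(* If [b] divided [3 * a], coprimality would force [b] to be 1 or 3. *)
have b_ndvd j : (3 * a == j * b)%N = false.
  apply/negP => /eqP e.
  have : (b %| 3)%N.
    by rewrite -(@Gauss_dvdl _ _ a) 1?coprime_sym // e dvdn_mull.
  by rewrite dvdn_divisors // !inE; lia.
have [j] : exists j, (j * b < 3 * a < j.+1 * b)%N.
  exists (3 * a %/ b)%N; rewrite ltn_neqAle leq_divM eq_sym b_ndvd /=.
  by rewrite -ltn_divLR //; lia.
move=> jb; rewrite (cot_sum1E _ _ j) // !mulf_eq0 b_neq0 invr_eq0 pnatr_eq0 orbF /=.
rewrite subr_eq0 eq_sym pnatr_eq1.
by apply/eqP/idP => [ej|]; [rewrite ej in jb; lia | nia].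
Qed.

End CotangentSums.

(** The bounds on [A] and [B] make every counted integer a natural number below [b]. *)
Lemma gtotient_card (b : nat) (A B : int) : 0 <= A -> B < b%:Z ->
  gtotient b A B = #|[set a : 'I_b | (A <= a%:Z <= B) && coprime a b]|.
Proof.
move=> A0 Bb; rewrite /gtotient.
rewrite (reindex_fsbig (fun a : 'I_b => a%:Z)
  [set` [pred a : 'I_b | (A <= a%:Z <= B) && coprime a b]]) /=; last first.
  split => [a /= /andP[AB co]|a c _ _ /= [/val_inj]//|k /= [/andP[Ak kB] co]].
    by split => //; rewrite /coprimez gcdzC.
  case: k Ak kB co => [n|n] Ak kB co; last by lia.
  have nb : (n < b)%N by lia.
  by exists (Ordinal nb) => //=; rewrite inE /= Ak kB coprime_sym.
rewrite -(bigfs _ (index_enum_uniq _)) /=; last first.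
  by move=> a _; rewrite mem_index_enum.
by rewrite -[LHS]/(\sum_(a | _) 1)%N sum1_card; apply: eq_card => a; rewrite !inE.
Qed.

Theorem corollary1p4 (R : realType) (b : nat) (hb2 : (2 <= b)%N)
    (hb3 : b <> 3%N) :
  #|[set a : 'I_b | [&& (1 <= a)%N, coprime a b & cot_sum R 1 a b == 0]]| =
  gtotient b (Num.ceil ((b%:R + 1) / 3 : R)) (Num.floor ((2 * b%:R - 1) / 3 : R)).
Proof.
have b_ge2 : 2 <= b%:R :> R by rewrite (ler_nat _ 2).
rewrite gtotient_card; first last.
- rewrite floor_lt_int -pmulrn; lra.
- by rewrite ceil_ge0; lra.
apply: eq_card => a; rewrite !inE.
(* Over the integers, [b + 1 <= 3 * a] is the strict bound [b < 3 * a]; likewise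
   [3 * a <= 2 * b - 1] below. *)
have -> : (Num.ceil ((b%:R + 1) / 3 : R) <= a%:Z) = (b < 3 * a)%N.
  by rewrite ceil_le_int -pmulrn ler_pdivrMr // natr1 -natrM ler_nat mulnC.
have -> : (a%:Z <= Num.floor ((2 * b%:R - 1) / 3 : R)) = (3 * a < 2 * b)%N.
  rewrite floor_ge_int -pmulrn ler_pdivlMr // lerBrDr -!natrM natr1.
  by rewrite ler_nat mulnC.
have ab := ltn_ord a.
have [a0|a_gt0] := posnP a; first by rewrite a0 muln0.
have [co|] := boolP (coprime a b); last by rewrite andbF.
by rewrite cot_sum1_eq0 ?a_gt0 // andbT.
Qed.
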